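(* Let $\mathscr C$ be a unit circle, let $\mathscr A$ be an arc of $\mathscr C$ that is less than half of $\mathscr C$, let $n$ be a natural number greater than two, and let $(P_1,\dots,P_{n+1})$ be a regular clockwise oriented partition of $\mathscr A$. For $i\in\{2,\dots,n+1\}$ let $P_{1,i}$ be the intersection point of the lines tangent to $\mathscr C$ at $P_1$ and at $P_i$. For a natural number $m\ge 1$ with $m<n$, let $L_m$ be the length of the line segment $\overline{P_1P_{1,m+1}}$ and let $L_n$ be the length of the line segment $\overline{P_1P_{1,n+1}}$. Then $$n\,L_m < m\,L_n .$$
   Context: A clockwise oriented partition of an arc $\mathscr A$ is a finite sequence of points of $\mathscr A$, in clockwise order, whose first and last points are the endpoints of $\mathscr A$. It is regular if all pairs of adjacent points of the sequence are at the same distance from each other. Since $\mathscr A$ is less than half of $\mathscr C$, the tangent lines to $\mathscr C$ at two distinct points of $\mathscr A$ meet in exactly one point. Natural numbers start at $1$. *)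

(* Defs.v *)
(* World: Stdlib (classical real numbers). *)
From Stdlib Require Export Reals.
Open Scope R_scope.

Definition point : Type := (R * R)%type.

Definition distance (X Y : point) : R := dist_euc (fst X) (snd X) (fst Y) (snd Y).

Definition unit_circle (c : point) : point -> Prop := fun X => distance c X = 1.

(* An arc of the unit circle centred at [c] is encoded by the polar angle of the
   endpoint from which it is traversed clockwise and by its angular extent; since
   the radius is 1, the extent is also its length. *)
Record arc (c : point) : Type := Arc {
  arc_angle : R;
  arc_extent : R;
  arc_extent_range : 0 < arc_extent < 2 * PI
}.
Arguments arc_angle {c} _.
Arguments arc_extent {c} _.

(* The polar angle decreases with [t], so increasing [t] means moving clockwise. *)
Definition arc_point {c : point} (A : arc c) (t : R) : point :=
  (fst c + cos (arc_angle A - t), snd c + sin (arc_angle A - t)).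

Definition arc_first {c : point} (A : arc c) : point := arc_point A 0.
Definition arc_last {c : point} (A : arc c) : point := arc_point A (arc_extent A).

(* Half of the circle has length [PI]. *)
Definition less_than_half {c : point} (A : arc c) : Prop := arc_extent A < PI.

(* The sequence is [P 1, ..., P k]; other values of [P] are irrelevant.  Since the
   extent is less than [2 * PI], [t i] is determined by [P i].  Repeated points are
   not excluded here. *)
Definition clockwise_partition {c : point} (A : arc c) (k : nat)
    (P : nat -> point) : Prop :=
  (exists t : nat -> R,
     (forall i : nat, (1 <= i <= k)%nat ->
        0 <= t i <= arc_extent A /\ P i = arc_point A (t i)) /\
     (forall i : nat, (1 <= i < k)%nat -> t i <= t (S i))) /\
  P 1%nat = arc_first A /\ P k = arc_last A.

Definition regular (k : nat) (P : nat -> point) : Prop :=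
  forall i j : nat, (1 <= i < k)%nat -> (1 <= j < k)%nat ->
    distance (P i) (P (S i)) = distance (P j) (P (S j)).

Definition is_line (l : point -> Prop) : Prop :=
  exists a b d : R, (a <> 0 \/ b <> 0) /\
    forall X : point, l X <-> a * fst X + b * snd X = d.

Definition tangent_at (c : point) (l : point -> Prop) (P : point) : Prop :=
  is_line l /\ forall X : point, l X /\ unit_circle c X <-> X = P.

Definition tangents_meet_at (c P Q X : point) : Prop :=
  exists l m : point -> Prop,
    tangent_at c l P /\ tangent_at c m Q /\
    forall Y : point, l Y /\ m Y <-> Y = X.

(* Main.v *)
Require Import Defs.
From Stdlib Require Import Reals.
From Stdlib Require Import Lra Lia.
Open Scope R_scope.

(** Equal chords of an arc shorter than a half circle subtend equal angles, so
    [P i] lies at angle [(i - 1) * d] from [P 1], where [n * d < PI].  The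
    tangent length from a point to the tangent at angular distance [th] is
    [tan (th / 2)], and the claim becomes the strict monotonicity of [tan x / x]
    on [(0, PI / 2)], which follows from the strict convexity of [tan]. *)

Lemma tan_mul_lt (u v : R) :
  0 < u -> u < v -> v < PI / 2 -> v * tan u < u * tan v.
Proof.
  intros Hu Huv Hv.
  assert (Hd : forall a b, 0 <= a -> b < PI / 2 -> forall x, a <= x <= b ->
    derivable_pt_lim tan x (1 + tan x ^ 2)).
  { intros a b Ha Hb x Hx.
    assert (Hx' : - PI / 2 < x < PI / 2) by lra.
    rewrite <- (derive_pt_tan x Hx').
    apply (proj2_sig (derivable_pt_tan x Hx')). }
  destruct (MVT_cor2 tan (fun x => 1 + tan x ^ 2) 0 u Hu) as [x [Ex Hx]].
  { apply Hd; lra. }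
  destruct (MVT_cor2 tan (fun x => 1 + tan x ^ 2) u v Huv) as [y [Ey Hy]].
  { apply Hd; lra. }
  assert (Hxy : tan x < tan y) by (apply tan_increasing; lra).
  assert (Hx0 : 0 < tan x) by (apply tan_gt_0; lra).
  rewrite tan_0 in Ex.
  replace (tan v) with ((1 + tan y ^ 2) * (v - u) + tan u) by lra.
  replace (tan u) with ((1 + tan x ^ 2) * u) by lra.
  assert (tan x ^ 2 < tan y ^ 2) by nra.
  assert (0 < u * (v - u)) by nra.
  nra.
Qed.

Lemma distance_arc_point (c : point) (A : arc c) (s t : R) :
  0 <= t - s <= 2 * PI ->
  distance (arc_point A s) (arc_point A t) = 2 * sin ((t - s) / 2).
Proof.
  intros H. unfold distance, dist_euc, arc_point; simpl.
  assert (Hs : 0 <= sin ((t - s) / 2)) by (apply sin_ge_0; lra).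
  rewrite <- (sqrt_Rsqr (2 * sin ((t - s) / 2))) by lra.
  f_equal.
  set (x := arc_angle A - s). set (y := arc_angle A - t).
  assert (E : cos (x - y) = 1 - 2 * sin ((t - s) / 2) * sin ((t - s) / 2)).
  { rewrite <- cos_2a_sin. f_equal. unfold x, y. field. }
  rewrite cos_minus in E.
  pose proof (sin2_cos2 x) as Ex. pose proof (sin2_cos2 y) as Ey.
  unfold Rsqr in *. nra.
Qed.

Lemma arc_point_chord_inj (c : point) (A : arc c) (s t s' t' : R) :
  0 <= t - s <= PI -> 0 <= t' - s' <= PI ->
  distance (arc_point A s) (arc_point A t) =
    distance (arc_point A s') (arc_point A t') ->
  t - s = t' - s'.
Proof.
  intros H H' E.
  rewrite !distance_arc_point in E by lra.
  apply Rmult_eq_reg_l in E; [|lra].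
  apply sin_inj in E; lra.
Qed.

Lemma arc_point_inj (c : point) (A : arc c) (s t : R) :
  0 <= t - s <= PI -> arc_point A s = arc_point A t -> s = t.
Proof.
  intros H E.
  assert (t - s = s - s); [|lra].
  apply (arc_point_chord_inj c A); try lra.
  now rewrite E.
Qed.

Lemma regular_partition_angles (c : point) (A : arc c) (n : nat)
    (P : nat -> point) :
  less_than_half A -> (1 <= n)%nat ->
  clockwise_partition A (n + 1) P -> regular (n + 1) P ->
  forall k, (k <= n)%nat ->
    P (S k) = arc_point A (INR k * (arc_extent A / INR n)).
Proof.
  intros hA hn [[t [Ht Hmono]] [Hfirst Hlast]] hreg.
  unfold less_than_half in hA.
  assert (t1 : t 1%nat = 0).
  { destruct (Ht 1%nat) as [B E]; [lia|].
    symmetry; apply (arc_point_inj c A); [lra|].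
    rewrite <- E, Hfirst. reflexivity. }
  assert (tn : t (n + 1)%nat = arc_extent A).
  { destruct (Ht (n + 1)%nat) as [B E]; [lia|].
    apply (arc_point_inj c A); [lra|].
    rewrite <- E, Hlast. reflexivity. }
  assert (Hstep : forall i, (1 <= i < n + 1)%nat -> t (S i) - t i = t 2%nat - t 1%nat).
  { intros i Hi.
    destruct (Ht i) as [B E]; [lia|].
    destruct (Ht (S i)) as [B' E']; [lia|].
    destruct (Ht 1%nat) as [B1 E1]; [lia|].
    destruct (Ht 2%nat) as [B2 E2]; [lia|].
    pose proof (Hmono i Hi). pose proof (Hmono 1%nat ltac:(lia)).
    apply (arc_point_chord_inj c A); try lra.
    rewrite <- E, <- E', <- E1, <- E2.
    apply hreg; lia. }
  assert (Hlin : forall k, (k <= n)%nat -> t (S k) = INR k * (t 2%nat - t 1%nat)).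
  { induction k as [|k IH]; intros Hk.
    - simpl. lra.
    - rewrite S_INR. pose proof (Hstep (S k) ltac:(lia)).
      specialize (IH ltac:(lia)). lra. }
  assert (Hn0 : 0 < INR n) by (apply lt_0_INR; lia).
  assert (Hd : t 2%nat - t 1%nat = arc_extent A / INR n).
  { rewrite <- tn, Nat.add_1_r, (Hlin n) by lia. field. lra. }
  intros k Hk.
  destruct (Ht (S k)) as [_ E]; [lia|].
  now rewrite E, Hlin, Hd by lia.
Qed.

Lemma tangent_at_inner (c P X : point) (l : point -> Prop) :
  tangent_at c l P -> l X ->
  (fst P - fst c) * (fst X - fst c) + (snd P - snd c) * (snd X - snd c) = 1.
Proof.
  intros [[a [b [d [Hab Hl]]]] Hu] HX.
  destruct (proj2 (Hu P) eq_refl) as [HP HC].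
  apply Hl in HX. apply Hl in HP.
  unfold unit_circle, distance, dist_euc in *.
  destruct c as [c1 c2], P as [p1 p2], X as [x1 x2]; simpl in *.
  assert (HN : 0 < a * a + b * b) by nra.
  assert (HC2 : (p1 - c1) * (p1 - c1) + (p2 - c2) * (p2 - c2) = 1).
  { apply (f_equal Rsqr) in HC. rewrite Rsqr_sqrt in HC by
      (apply Rplus_le_le_0_compat; apply Rle_0_sqr).
    unfold Rsqr in HC. lra. }
  (* Reflecting [P] in the normal through [c] gives the second intersection of
     the line with the circle, so tangency forces this reflection to fix [P]. *)
  set (k := a * (p2 - c2) - b * (p1 - c1)).
  set (e := 2 * k / (a * a + b * b)).
  assert (He : e * (a * a + b * b) = 2 * k) by (unfold e; field; lra).
  assert (Q : (p1 + e * b, p2 - e * a) = (p1, p2)).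
  { apply Hu. split.
    - apply Hl. simpl. lra.
    - simpl. rewrite <- sqrt_1. f_equal. unfold Rsqr.
      replace (_ + _) with
        ((p1 - c1) * (p1 - c1) + (p2 - c2) * (p2 - c2)
          + e * (e * (a * a + b * b) - 2 * k)) by (unfold k; ring).
      rewrite He, HC2. ring. }
  injection Q as Q1 Q2.
  assert (Ek : k = 0) by nra.
  assert (Ek' : a * (p2 - c2) = b * (p1 - c1)) by (unfold k in Ek; lra).
  set (g := a * (p1 - c1) + b * (p2 - c2)).
  assert (Ea : a = g * (p1 - c1)).
  { unfold g. transitivity (a * ((p1 - c1) * (p1 - c1) + (p2 - c2) * (p2 - c2))).
    - rewrite HC2. ring.
    - rewrite Rmult_plus_distr_l, <- (Rmult_assoc a (p2 - c2)), Ek'. ring. }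
  assert (Eb : b = g * (p2 - c2)).
  { unfold g. transitivity (b * ((p1 - c1) * (p1 - c1) + (p2 - c2) * (p2 - c2))).
    - rewrite HC2. ring.
    - rewrite Rmult_plus_distr_l, <- (Rmult_assoc b (p1 - c1)), <- Ek'. ring. }
  assert (Hg : g <> 0) by (intro E; rewrite E in Ea, Eb; nra).
  apply (Rmult_eq_reg_l g); [|exact Hg].
  transitivity (a * (x1 - c1) + b * (x2 - c2)).
  - rewrite Ea, Eb at 1. ring.
  - unfold g. lra.
Qed.

Lemma tangent_length (c : point) (A : arc c) (th : R) (X : point) :
  0 < th < PI ->
  tangents_meet_at c (arc_point A 0) (arc_point A th) X ->
  distance (arc_point A 0) X = tan (th / 2).
Proof.
  intros Hth [l [m [Hl [Hm Hlm]]]].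
  destruct (proj2 (Hlm X) eq_refl) as [HlX HmX].
  apply (tangent_at_inner c _ X) in Hl; [|exact HlX].
  apply (tangent_at_inner c _ X) in Hm; [|exact HmX].
  destruct c as [c1 c2], X as [x1 x2].
  unfold arc_point, distance, dist_euc in *; simpl in *.
  rewrite Rminus_0_r in *.
  rewrite cos_minus, sin_minus in Hm.
  set (al := arc_angle A) in *.
  assert (Hs : 0 < sin (th / 2)) by (apply sin_gt_0; lra).
  assert (Hc : 0 < cos (th / 2)) by (apply cos_gt_0; lra).
  pose proof (sin2_cos2 al) as Eal. pose proof (sin2_cos2 (th / 2)) as Eth.
  unfold Rsqr in Eal, Eth.
  (* [s] is the signed distance from [P] to [X] along the tangent at [P]. *)
  set (s := sin al * (x1 - c1) - cos al * (x2 - c2)).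
  assert (Hl' : cos al * (x1 - c1) + sin al * (x2 - c2) = 1) by lra.
  assert (E : cos th + s * sin th = 1).
  { transitivity (cos th * (cos al * (x1 - c1) + sin al * (x2 - c2)) + s * sin th).
    - rewrite Hl'. ring.
    - rewrite <- Hm. unfold s. ring. }
  replace th with (2 * (th / 2)) in E by field.
  rewrite cos_2a_sin, sin_2a in E.
  assert (Es : s = tan (th / 2)).
  { unfold tan. apply (Rmult_eq_reg_l (2 * sin (th / 2) * cos (th / 2))); [|nra].
    transitivity (2 * sin (th / 2) * sin (th / 2)); [lra|field; lra]. }
  assert (Ht : 0 < tan (th / 2)) by (apply tan_gt_0; lra).
  rewrite <- (sqrt_Rsqr (tan (th / 2))) by lra.
  f_equal. rewrite <- Es. unfold Rsqr.
  assert (E1 : x1 - c1 = cos al + s * sin al).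
  { transitivity ((sin al * sin al + cos al * cos al) * (x1 - c1)).
    - rewrite Eal. ring.
    - transitivity (cos al * (cos al * (x1 - c1) + sin al * (x2 - c2)) + s * sin al).
      + unfold s. ring.
      + rewrite Hl'. ring. }
  assert (E2 : x2 - c2 = sin al - s * cos al).
  { transitivity ((sin al * sin al + cos al * cos al) * (x2 - c2)).
    - rewrite Eal. ring.
    - transitivity (sin al * (cos al * (x1 - c1) + sin al * (x2 - c2)) - s * cos al).
      + unfold s. ring.
      + rewrite Hl'. ring. }
  clearbody s.
  replace x1 with (c1 + (cos al + s * sin al)) by lra.
  replace x2 with (c2 + (sin al - s * cos al)) by lra.
  transitivity (s * s * (sin al * sin al + cos al * cos al)); [ring|].
  rewrite Eal. ring.
Qed.

Theorem theorem3 (c : point) (A : arc c) (hA : less_than_half A)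
    (n : nat) (hn : (2 < n)%nat)
    (P : nat -> point)
    (hP : clockwise_partition A (n + 1) P) (hreg : regular (n + 1) P)
    (T : nat -> point)
    (hT : forall i : nat, (2 <= i <= n + 1)%nat ->
            tangents_meet_at c (P 1%nat) (P i) (T i))
    (m : nat) (hm : (1 <= m)%nat) (hmn : (m < n)%nat) :
  INR n * distance (P 1%nat) (T (m + 1)%nat) < INR m * distance (P 1%nat) (T (n + 1)%nat).
Proof.
  pose proof (regular_partition_angles c A n P hA ltac:(lia) hP hreg) as HP.
  pose proof (arc_extent_range c A) as [HE _].
  unfold less_than_half in hA.
  assert (Hm0 : 0 < INR m) by (apply lt_0_INR; lia).
  assert (Hmn : INR m < INR n) by (apply lt_INR; lia).
  set (d := arc_extent A / INR n) in *.
  assert (Hnd : INR n * d = arc_extent A) by (unfold d; field; lra).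
  assert (Hd : 0 < d) by (apply Rdiv_lt_0_compat; lra).
  assert (HP1 : P 1%nat = arc_point A 0).
  { rewrite HP by lia. simpl. now rewrite Rmult_0_l. }
  assert (HL : forall k, (1 <= k <= n)%nat ->
    distance (P 1%nat) (T (k + 1)%nat) = tan (INR k * d / 2)).
  { intros k Hk.
    assert (0 < INR k) by (apply lt_0_INR; lia).
    assert (INR k <= INR n) by (apply le_INR; lia).
    rewrite HP1, Nat.add_1_r. apply tangent_length; [nra|].
    rewrite <- HP1, <- HP by lia.
    apply hT; lia. }
  rewrite !HL by lia.
  pose proof (tan_mul_lt (INR m * d / 2) (INR n * d / 2)
    ltac:(nra) ltac:(nra) ltac:(nra)) as H.
  apply (Rmult_lt_reg_l (d / 2)); [lra|].
  lra.
Qed.
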